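(* Let $A=\big[\ast_{T\in 2^{[c]}}A_T(k_T)\big]\in\{0,1\}^{c\times m}$ be a nonzero matrix with $k_T\ge 0$, and let $n\ge m$ with $n\ge\max\{k_{\mathcal{C}}-1 \mid \mathcal{C}\text{ an antichain in }2^{[c]}\text{ with }k_{\mathcal{C}}\ge 1\}$, where $\mathcal C$ is nonempty. Then the Alexander dual $I_n^\vee$ of the ideal $I_n=\langle\operatorname{Sym}(n)\cdot\mathbf{x}^A\rangle\subset R_n$ is minimally generated by the $\operatorname{Sym}(n)$-orbits of the monomials in the set $$\bigcup_{\substack{\mathcal{C}\text{ antichain}\\ \varnothing\ne\mathcal{C}\subset 2^{[c]},\ k_{\mathcal{C}}\ge 1}}\{\mathbf{x}^B\mid B\in M\mathcal{G}_{\mathcal{C}}(n)\}.$$ Here, for an antichain $\mathcal{C}$ with $k_{\mathcal C}\ge 1$, $M\mathcal{G}_{\mathcal{C}}(n)$ is the set of all matrices $\big[\ast_{T\in\mathcal{C}}A_T(j_T)\big]$ with integers $j_T\ge 0$ such that $\sum_{T\in\mathcal{C}}j_T=n+1-k_{\mathcal{C}}$ and $$\sum_{T\in\mathcal{C}-\langle\mathcal{C}'\rangle}j_T>k_{\mathcal{C}'}-k_{\mathcal{C}}$$ for every nonempty antichain $\mathcal{C}'\ne\mathcal{C}$ contained in $\langle\mathcal{C}\rangle_{\mathrm{lower}}$.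
   Context: $R_n=\mathbf{k}[x_{i,j}\mid i\in[c],j\in[n]]$ over a field $\mathbf{k}$, with $\operatorname{Sym}(n)$ acting by $\sigma\cdot x_{i,j}=x_{i,\sigma(j)}$. For $B=[b_{i,j}]\in\{0,1\}^{c\times n}$, $\mathbf{x}^B=\prod x_{i,j}^{b_{i,j}}$; a matrix with fewer than $n$ columns is padded with zero columns to obtain a $c\times n$ matrix. For $T\subseteq[c]$ and $k\ge 0$, $A_T(k)$ is the $c\times k$ matrix all of whose columns are the indicator vector of $T$; $[\ast_{T\in\mathcal{S}}A_T(k_T)]$ is the horizontal concatenation of the blocks $A_T(k_T)$ in a fixed order of the subsets $T\in\mathcal{S}$. An antichain in $2^{[c]}$ is a set of pairwise incomparable subsets of $[c]$. For $\mathcal{C}\subseteq 2^{[c]}$, $\langle\mathcal{C}\rangle=\{T\subseteq[c]\mid T\supseteq S\text{ for some }S\in\mathcal{C}\}$ and $\langle\mathcal{C}\rangle_{\mathrm{lower}}=\{T\subseteq[c]\mid T\subseteq S\text{ for some }S\in\mathcal{C}\}$. For $J\subseteq 2^{[c]}$, $\overline{J}=\{[c]-T\mid T\in J\}$. Set $k_{\mathcal{C}}:=\sum_{T\in 2^{[c]}-\overline{\langle\mathcal{C}\rangle}}k_T$. The Alexander dual of a squarefree monomial ideal $I$ is $I^\vee=\langle\mathbf{m}\mid P_{\mathbf{m}}\in\operatorname{Ass}(I)\rangle$, where $P_{\mathbf{m}}$ is generated by the variables dividing the squarefree monomial $\mathbf{m}$. ''Minimally generated by the orbits of the monomials in a set''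 means the union of these orbits is the unique minimal monomial generating set. *)

(* Defs.v *)
From HB Require Import structures.
From mathcomp Require Import all_boot all_order all_algebra all_fingroup.
From mathcomp Require Import mpoly.

Set Implicit Arguments.
Unset Strict Implicit.
Unset Printing Implicit Defensive.

Import GRing.Theory.
Local Open Scope ring_scope.

(* Subsets of a ring, and in particular its ideals, are [Prop]-valued
   predicates, compared extensionally. *)

Definition incl_pred (X : Type) (P Q : X -> Prop) : Prop :=
  forall x, P x -> Q x.

Definition eq_pred (X : Type) (P Q : X -> Prop) : Prop :=
  forall x, P x <-> Q x.

Section Ideals.
Variable R : comNzRingType.
Implicit Types (I P S : R -> Prop).

Definition is_ideal I : Prop :=
  [/\ I 0,
      forall a b, I a -> I b -> I (a + b)
    & forall r a, I a -> I (r * a)].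

Definition ideal_gen S : R -> Prop :=
  fun p => forall I, is_ideal I -> incl_pred S I -> I p.

Definition is_prime_ideal P : Prop :=
  [/\ is_ideal P, ~ P 1 & forall a b, P (a * b) -> P a \/ P b].

(* P is in Ass(I): it is prime and is the annihilator in R / I of the class
   of some f. *)
Definition associated_prime I P : Prop :=
  is_prime_ideal P /\ exists f : R, forall g : R, P g <-> I (g * f).

End Ideals.

Section MonomialIdeals.
Variables (F : fieldType) (N : nat).
Notation R := {mpoly F[N]}.

Definition is_monomial (p : R) : Prop := exists m : 'X_{1..N}, p = 'X_[m].

Definition squarefree (m : 'X_{1..N}) : bool := [forall l, m l <= 1]%N.

Definition monomial_prime (m : 'X_{1..N}) : R -> Prop :=
  ideal_gen (fun p : R => exists2 l : 'I_N, (U_(l) <= m)%MM & p = 'X_l).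

Definition alexander_dual (I : R -> Prop) : R -> Prop :=
  ideal_gen (fun p : R => exists m : 'X_{1..N},
    [/\ squarefree m, associated_prime I (monomial_prime m) & p = 'X_[m]]).

Definition minimal_monomial_generators (I G : R -> Prop) : Prop :=
  [/\ incl_pred G is_monomial,
      eq_pred (ideal_gen G) I
    & forall G' : R -> Prop,
        incl_pred G' G -> eq_pred (ideal_gen G') I -> incl_pred G G'].

Definition unique_minimal_monomial_generators (I G : R -> Prop) : Prop :=
  minimal_monomial_generators I G /\
  forall G' : R -> Prop, minimal_monomial_generators I G' -> eq_pred G' G.

End MonomialIdeals.

Section SymAction.
Variables (F : fieldType) (c n : nat).

(* The polynomial library indexes variables by ordinals: the variable x_{i,j}
   is the one whose index is the rank of (i, j) in 'I_c * 'I_n. *)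
Definition nvars : nat := #|{: 'I_c * 'I_n}|.

Definition xvar (i : 'I_c) (j : 'I_n) : {mpoly F[nvars]} :=
  'X_(enum_rank (i, j)).

Definition xmon (B : 'M[bool]_(c, n)) : {mpoly F[nvars]} :=
  \prod_(i < c) \prod_(j < n) xvar i j ^+ B i j.

(* The F-algebra endomorphism sending x_{i,j} to x_{i,s(j)}. *)
Definition sym_act (s : 'S_n) (p : {mpoly F[nvars]}) : {mpoly F[nvars]} :=
  p \mPo [tuple xvar (enum_val l).1 (s (enum_val l).2) | l < nvars].

Definition sym_orbits (X : {mpoly F[nvars]} -> Prop) :
    {mpoly F[nvars]} -> Prop :=
  fun p => exists (s : 'S_n) (q : {mpoly F[nvars]}), X q /\ p = sym_act s q.

End SymAction.

Section Matrices.
Variable c : nat.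
Implicit Types (T : {set 'I_c}) (C J S : {set {set 'I_c}}).

Definition A_block T (w : nat) : 'M[bool]_(c, w) :=
  \matrix_(i < c, j < w) (i \in T).

(* The blocks A_T(k T), T in S, side by side in the order of [enum S]. *)
Definition A_concat S (k : {set 'I_c} -> nat) :
    'M[bool]_(c, \sum_(t < #|S|) k (enum_val t)) :=
  \mxrow_(t < #|S|) A_block (enum_val t) (k (enum_val t)).

(* Padding with zero columns; only meant for w <= n (further columns would be
   dropped). *)
Definition pad_cols (n w : nat) (B : 'M[bool]_(c, w)) : 'M[bool]_(c, n) :=
  \matrix_(i < c, j < n)
    (if insub (val j) is Some j' then B i (j' : 'I_w) else false).

Definition antichain C : bool :=
  [forall S in C, forall T in C, (S \subset T) ==> (S == T)].

Definition upper C : {set {set 'I_c}} :=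
  [set T : {set 'I_c} | [exists S in C, S \subset T]].

Definition lower C : {set {set 'I_c}} :=
  [set T : {set 'I_c} | [exists S in C, T \subset S]].

Definition compl_family J : {set {set 'I_c}} := [set ~: T | T in J].

Definition k_of (k : {set 'I_c} -> nat) C : nat :=
  (\sum_(T in ~: compl_family (upper C)) k T)%N.

(* The matrices of MG_C(n), padded to n columns. The differences are taken in
   the integers, since k_{C'} - k_C may be negative. *)
Definition MG (k : {set 'I_c} -> nat) C (n : nat) (B : 'M[bool]_(c, n)) : Prop :=
  exists j : {set 'I_c} -> nat,
    [/\ B = pad_cols n (A_concat C j),
        (\sum_(T in C) j T)%N%:Z = n%:Z + 1 - (k_of k C)%:Z
      & forall C' : {set {set 'I_c}},
          antichain C' -> C' != set0 -> C' != C -> C' \subset lower C ->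
          (k_of k C')%:Z - (k_of k C)%:Z
            < (\sum_(T in C :\: upper C') j T)%N%:Z].

End Matrices.

Definition I_n (F : fieldType) (c w n : nat) (A : 'M[bool]_(c, w)) :
    {mpoly F[nvars c n]} -> Prop :=
  ideal_gen (sym_orbits (fun p => p = xmon F (pad_cols n A))).

Arguments I_n F {c w} n A.

(* Main.v *)
Require Import Defs.
From HB Require Import structures.
From mathcomp Require Import all_boot all_order all_algebra all_fingroup.
From mathcomp Require Import mpoly zify ring.
From Stdlib Require Import Classical_Prop.

(** A squarefree monomial prime [P_m] is associated to the ideal generated by
    the orbit of [x^A] iff [m] is a minimal vertex cover of that orbit: it meets
    every monomial of the orbit, and no proper divisor of [m] does. Reading the
    columns of [B] as subsets [B_j] of [[c]], [x^B] is a cover iff the columns of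
    [A] cannot be matched injectively into the sets [[c] - B_j] containing them.
    By Hall's theorem this means that some nonempty antichain [C] satisfies
    [n + 1 <= k_C + #{j | B_j in <C>}]. In a minimal cover exactly [n + 1 - k_C]
    columns are nonzero and they lie in [C]; the inequalities defining [MG_C(n)]
    say that no other antichain inside the lower set of [C] certifies the cover,
    and they hold for a certificate [C] whose lower set is smallest. *)

(** * Hall's theorem and covers *)

(** Induction on the total size of the sets [F x]: elements are deleted while Hall's condition
    survives, until every set is a singleton and the choice is forced. *)
Lemma hall_marriage {T U : finType} (F : T -> {set U}) :
    (forall X : {set T}, #|X| <= #|\bigcup_(x in X) F x|) ->
  exists2 f : T -> U, injective f & forall x, f x \in F x.
Proof.
have [b] := ubnP (\sum_x #|F x|); elim: b F => // b IHb F ltFb hallF.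
(* If some [F x] has two elements then one of them can be deleted: otherwise
   two violating families share [x], and submodularity of
   [X |-> #|\bigcup_(y in X) F y|] contradicts Hall's condition. *)
have [/existsP[x /card_gt1P[u [v [Fu Fv neq_uv]]]]|] := boolP [exists x, 1 < #|F x|].
  pose rem w y := if y == x then F x :\ w else F y.
  have tight w : w \in F x ->
      ~ (exists2 f : T -> U, injective f & forall y, f y \in F y) ->
      exists2 Y : {set T}, x \notin Y &
        #|(\bigcup_(y in Y) F y) :|: (F x :\ w)| <= #|Y|.
    move=> Fw noF.
    have [hall_rem|] :=
        boolP [forall X : {set T}, #|X| <= #|\bigcup_(y in X) rem w y|].
      case: noF; have [||f f_inj f_rem] := IHb (rem w); last first.
      - exists f => // y; have := f_rem y; rewrite /rem.
        by case: eqP => [-> /setD1P[]|].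
      - by move=> X; apply: (forallP hall_rem).
      - rewrite -ltnS; apply: leq_trans ltFb; rewrite ltnS.
        rewrite (bigD1 x) //= [X in _ < X](bigD1 x) //=.
        rewrite /rem eqxx (cardsD1 w (F x)) Fw ltnS leq_add2l.
        by apply: leq_sum => y /negPf ->.
    case/forallPn=> X; rewrite -ltnNge => ltX.
    have remE (Y : {set T}) :
        x \notin Y -> \bigcup_(y in Y) rem w y = \bigcup_(y in Y) F y.
      move=> xY; apply: eq_bigr => y yY; rewrite /rem.
      by case: eqP => // yx; rewrite -yx yY in xY.
    have xX : x \in X.
      by apply: contraLR ltX => xX; rewrite remE // -leqNgt.
    exists (X :\ x); rewrite ?setD11 //.
    move: ltX; rewrite (cardsD1 x) xX (big_setD1 x) //= remE ?setD11 //.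
    by rewrite /rem eqxx setUC.
  apply: NNPP => noF.
  have [Y1 xY1 leY1] := tight u Fu noF; have [Y2 xY2 leY2] := tight v Fv noF.
  pose N (Y : {set T}) := \bigcup_(y in Y) F y; rewrite -!/(N _) in leY1 leY2.
  (* As [u] and [v] differ, [F x :\ u] and [F x :\ v] together cover [F x]. The extra member [x]
     makes the union and intersection bounds add up to [#|Y1| + #|Y2| + 1 <= #|Y1| + #|Y2|]. *)
  have leU : N (x |: (Y1 :|: Y2)) \subset
      (N Y1 :|: (F x :\ u)) :|: (N Y2 :|: (F x :\ v)).
    apply/bigcupsP => y; rewrite !inE => /or3P[/eqP->|yY|yY]; apply/subsetP => w wF.
    - rewrite !inE wF !andbT; have [->|] := eqVneq w u; rewrite ?neq_uv ?orbT //.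
    - by rewrite !inE (subsetP (bigcup_sup y yY) w wF).
    - by rewrite !inE (subsetP (bigcup_sup y yY) w wF) !orbT.
  have leI : N (Y1 :&: Y2) \subset
      (N Y1 :|: (F x :\ u)) :&: (N Y2 :|: (F x :\ v)).
    apply/bigcupsP => y /setIP[yY1 yY2]; apply/subsetP => w wF.
    by rewrite !inE (subsetP (bigcup_sup y yY1) w wF) (subsetP (bigcup_sup y yY2) w wF).
  have := leq_trans (hallF _) (subset_leq_card leU).
  have := leq_trans (hallF _) (subset_leq_card leI).
  rewrite cardsU1 !inE negb_or xY1 xY2 /=.
  have := cardsUI Y1 Y2; have := cardsUI (N Y1 :|: (F x :\ u)) (N Y2 :|: (F x :\ v)).
  lia.
rewrite negb_exists => /forallP F1.
have Fset x : exists u, F x == [set u].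
  have /cards1P[u ->] : #|F x| == 1; last by exists u.
  by rewrite eqn_leq leqNgt F1 /=; have := hallF [set x]; rewrite cards1 big_set1.
pose f x := xchoose (Fset x).
have fE x : F x = [set f x] by apply/eqP; apply: (xchooseP (Fset x)).
exists f => [x y eqf|x]; last by rewrite fE set11.
have := hallF [set x; y]; rewrite cards2 bigcup_setU !big_set1 !fE eqf setUid cards1.
by case: eqP.
Qed.

Lemma subset_of_card {T : finType} (A : {set T}) d :
  d <= #|A| -> exists2 B : {set T}, B \subset A & #|B| = d.
Proof.
elim: d => [|d IHd] led; first by exists set0; rewrite ?sub0set ?cards0.
have [B sBA cardB] := IHd (ltnW led).
have /properP[_ [x xA xB]] : B \proper A by rewrite properEcard sBA cardB.
by exists (x |: B); rewrite ?cardsU1 ?xB ?cardB // subUset sub1set xA.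
Qed.

(** * Antichains and the up-sets and down-sets they generate *)

Section Families.
Context {c : nat}.
Implicit Types (S T : {set 'I_c}) (C D J V : {set {set 'I_c}}).

Lemma antichainP C :
  reflect {in C &, forall S T, S \subset T -> S = T} (antichain C).
Proof.
apply: (iffP forall_inP) => [antiC S T SC TC sST | antiC S SC].
  by move/forall_inP: (antiC S SC) => /(_ T TC); rewrite sST => /eqP.
by apply/forall_inP => T TC; apply/implyP => /antiC ->.
Qed.

Lemma upperP C T : reflect (exists2 S, S \in C & S \subset T) (T \in upper C).
Proof. by rewrite inE; apply: exists_inP. Qed.

Lemma lowerP C T : reflect (exists2 S, S \in C & T \subset S) (T \in lower C).
Proof. by rewrite inE; apply: exists_inP. Qed.

Lemma upperW C S T : S \in upper C -> S \subset T -> T \in upper C.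
Proof.
by case/upperP=> X XC sXS sST; apply/upperP; exists X => //; apply: subset_trans sST.
Qed.

Lemma sub_upper C : C \subset upper C.
Proof. by apply/subsetP => S SC; apply/upperP; exists S. Qed.

Lemma in_compl_family J T : (T \in compl_family J) = (~: T \in J).
Proof.
apply/imsetP/idP => [[S SJ ->]|TJ]; first by rewrite setCK.
by exists (~: T); rewrite ?setCK.
Qed.

(** The minimal members of a finite up-set generate it; this turns the up-set found through Hall's
    theorem into an antichain. *)
Lemma upper_minset V : (forall S T, S \in V -> S \subset T -> T \in V) ->
  exists2 C, antichain C & upper C = V.
Proof.
move=> upV; exists [set S | minset [pred X in V] S].
  apply/antichainP => S T; rewrite !inE => /minsetP[SV _] /minsetP[_ minT] sST.
  exact: minT.
apply/setP => T; apply/upperP/idP => [[S]|TV].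
  by rewrite inE => /minsetP[SV _]; apply: upV.
by have [S minS sST] := @minset_exists _ [pred X in V] T TV; exists S; rewrite ?inE.
Qed.

(** An antichain consists of the maximal members of its lower set and is thus determined by it. *)
Lemma lower_inj C D : antichain C -> antichain D ->
  C \subset lower D -> D \subset lower C -> C = D.
Proof.
suff sub (E E' : {set {set 'I_c}}) :
    antichain E -> E \subset lower E' -> E' \subset lower E -> E \subset E'.
  by move=> aC aD CD DC; apply/eqP; rewrite eqEsubset (sub C D) ?(sub D C).
move=> /antichainP aE /subsetP EE' /subsetP E'E; apply/subsetP => S SE.
have /lowerP[S' S'E' sSS'] := EE' S SE.
have /lowerP[S2 S2E sS'S2] := E'E S' S'E'.
suff -> : S = S' by [].
apply/eqP; rewrite eqEsubset sSS' /=.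
by rewrite (aE S S2) // (subset_trans sSS').
Qed.

Section Count.
Variable k : {set 'I_c} -> nat.

Lemma k_of_le C : k_of k C <= \sum_T k T.
Proof. by rewrite [X in _ <= X](bigID (mem (~: compl_family (upper C)))) leq_addr. Qed.

Lemma k_of_sub C D : D \subset C -> k_of k C <= k_of k D.
Proof.
move=> sDC; rewrite /k_of [X in _ <= X](big_setID (~: compl_family (upper C))).
rewrite (setIidPr _) ?leq_addr // setCS; apply/subsetP => T.
rewrite !in_compl_family => /upperP[S SD sST]; apply/upperP; exists S => //.
exact: subsetP SD.
Qed.

Lemma set0_notin C : 0 < k_of k C -> set0 \notin C.
Proof.
apply: contraTN => C0; rewrite /k_of big1 // => T.
by rewrite inE in_compl_family => /upperP[]; exists set0; rewrite ?sub0set.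
Qed.

(** * Certificates for vertex covers *)

Section Cover.
Variable n : nat.
Implicit Types b : 'I_n -> {set 'I_c}.

(* The certificate, provided by Hall's theorem, that the columns [b] form a
   vertex cover of the orbit of [x^A]. *)
Definition covers_by b C : bool :=
  [&& antichain C, C != set0 & n < k_of k C + #|[set j | b j \in upper C]|].

(** Here [a] and [b] list the columns of [A] and [B]. Their monomials meet when some [a (s j)] is
    not inside [~: b j], so a missed orbit element is a perfect matching. Families containing [set0]
    are excluded from the count because of the padding columns. *)
Lemma coverP (a : 'I_n -> {set 'I_c}) b :
    (forall J, set0 \notin J -> #|[set t | a t \in J]| = \sum_(T in J) k T) ->
  (forall s : 'S_n, exists j, ~~ (a (s j) \subset ~: b j)) <->
  (exists C, covers_by b C).
Proof.
move=> a_count.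
have cardC C : #|[set j | b j \in upper C]| +
    #|[set j | ~: b j \in ~: compl_family (upper C)]| = n.
  rewrite -[RHS]card_ord -(cardsC [set j | b j \in upper C]); congr (_ + _).
  by apply: eq_card => j; rewrite !inE in_compl_family setCK inE.
split=> [nomatch|[C /and3P[antiC C0 leC]] s].
  apply: NNPP => noC.
  have [|f f_inj f_in] :=
      @hall_marriage 'I_n 'I_n (fun t => [set j | a t \subset ~: b j]).
    move=> X; rewrite leqNgt; apply/negP => ltX.
    (* The neighbourhood of the violating [X] depends only on the up-set [U] of its columns, so all
       columns in [U] may be counted. The sets whose complements lie outside [U] form the up-set
       that the certificate generates. *)
    pose U := upper (a @: X).
    have aXU t : t \in X -> a t \in U.
      by move=> tX; apply/(subsetP (sub_upper _))/imset_f.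
    have NXE : \bigcup_(t in X) [set j | a t \subset ~: b j] = [set j | ~: b j \in U].
      apply/setP => j; rewrite [RHS]inE; apply/bigcupP/upperP.
        by case=> t tX; rewrite inE => sab; exists (a t); rewrite ?imset_f.
      by case=> _ /imsetP[t tX ->] sab; exists t; rewrite ?inE.
    (* With [set0] in [U] every position would be a neighbour, but [X] cannot have more than [n]
       elements. *)
    have U0 : set0 \notin U.
      apply: contraTN ltX => U0; rewrite NXE -leqNgt.
      apply: leq_trans (max_card _) _; rewrite -cardsT subset_leq_card //.
      by apply/subsetP => j _; rewrite inE (upperW _ _ _ U0) ?sub0set.
    have [S T|C antiC CE] := @upper_minset (~: compl_family U).
      rewrite !inE !in_compl_family => nSU sST; apply: contra nSU => TU.
      by apply: upperW TU _; rewrite setCS.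
    apply: noC; exists C; rewrite /covers_by antiC /=; apply/andP; split.
      apply: contraNneq U0 => C0; have : setT \notin upper C.
        by apply/upperP => -[S]; rewrite C0 inE.
      by rewrite CE inE negbK in_compl_family setCT.
    have UE : ~: compl_family (upper C) = U.
      apply/setP => T; rewrite CE in_setC in_compl_family in_setC.
      by rewrite in_compl_family setCK negbK.
    have := cardC C; rewrite /k_of UE -a_count //.
    have : #|X| <= #|[set t | a t \in U]|.
      apply: subset_leq_card; apply/subsetP => t /aXU aU; rewrite inE. exact: aU.
    move=> leX cardU; rewrite -[X in X < _]cardU addnC ltn_add2r.
    by apply: leq_trans leX; rewrite -NXE.
  (* [f] sends a column of [A] to a position in [B], whereas [s] sends a position to a column; hence
     the inverse. *)
  have [j] := nomatch (perm f_inj)^-1%g; have := f_in ((perm f_inj)^-1%g j).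
  by rewrite inE -[f _](permE f_inj) permKV => ->.
(* A missed orbit element would carry the columns counted by [k_of k C] injectively to positions
   with [b j] outside [upper C], and [leC] leaves too few of these. *)
apply/existsP; apply: contraTT leC; rewrite negb_exists => /forallP matchs.
rewrite -leqNgt -[X in _ <= X](cardC C) addnC leq_add2l /k_of -a_count.
  rewrite -(card_imset _ (@perm_inj _ s^-1)); apply: subset_leq_card.
  apply/subsetP => _ /imsetP[t + ->]; rewrite !inE !in_compl_family => nCa.
  apply: contra nCa => bC; apply: upperW bC _; rewrite setCS.
  by have := matchs (s^-1%g t); rewrite negbK permKV.
have /set0Pn[S SC] := C0; rewrite inE negbK in_compl_family setC0.
by apply/upperP; exists S; rewrite ?subsetT.
Qed.

Definition minimal_cover b : Prop :=
  (exists C, covers_by b C) /\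
  forall b', (forall j, b' j \subset b j) -> (exists C, covers_by b' C) -> b' =1 b.

(** These are the conditions of [MG] read on the columns. Given the cardinality equation, the last
    one says that [C'] does not reach the certificate bound by means of columns in [C]. *)
Lemma minimal_coverP b : \sum_T k T <= n ->
  minimal_cover b <->
  exists C, [/\ antichain C, C != set0 & 0 < k_of k C] /\
    [/\ forall j, b j != set0 -> b j \in C,
    #|[set j | b j \in C]| + k_of k C = n.+1
  & forall C', antichain C' -> C' != set0 -> C' != C -> C' \subset lower C ->
      k_of k C' < k_of k C + #|[set j | b j \in C :\: upper C']|].
Proof.
move=> le_kn; have k_le C : k_of k C <= n by apply: leq_trans (k_of_le C) le_kn.
have card_split (C C' : {set {set 'I_c}}) : #|[set j | b j \in C]| =
    #|[set j | b j \in C :&: upper C']| + #|[set j | b j \in C :\: upper C']|.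
  rewrite -(cardsID [set j | b j \in upper C']).
  by congr (_ + _); apply: eq_card => j; rewrite !inE.
have k_gt0 b' C : covers_by b' C -> 0 < k_of k C.
  case/and3P=> _ _; have := max_card [set j | b' j \in upper C].
  by rewrite card_ord; lia.
split=> [[[C0 cov0] minb]|[C [[antiC C0 kC] [bC cardC condC]]]]; last first.
  split.
    exists C; rewrite /covers_by antiC C0 -ltnS -cardC addnC ltnS leq_add2l.
    apply: subset_leq_card; apply/subsetP => j; rewrite inE => bjC.
    by rewrite inE; apply: (subsetP (sub_upper C)).
  move=> b' le_b' [C' covC']; have /and3P[antiC' C'0 ltC'] := covC'.
  (* Dropping the unused members of [C'] puts it inside [lower C]. *)
  pose D := [set T in C' | [exists j, T \subset b' j]].
  have sDC' : D \subset C' by apply/subsetP => T; rewrite inE => /andP[].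
  have covD : covers_by b' D.
    apply/and3P; split.
    - apply/antichainP => S T /(subsetP sDC') SC' /(subsetP sDC').
      exact: (antichainP _ antiC').
    - have /card_gt0P[j] : 0 < #|[set j | b' j \in upper C']|.
        by have := k_le C'; lia.
      rewrite inE => /upperP[T TC' sT]; apply/set0Pn; exists T.
      by rewrite inE TC'; apply/existsP; exists j.
    apply: leq_trans ltC' _; apply: leq_add; first exact: k_of_sub.
    apply: subset_leq_card; apply/subsetP => j; rewrite inE => /upperP[T TC' sT].
    rewrite inE; apply/upperP; exists T => //.
    by rewrite inE TC'; apply/existsP; exists j.
  have /and3P[antiD D0 ltD] := covD.
  have Dset0 := set0_notin _ (k_gt0 _ _ covD).
  have bD j : b' j \in upper D -> b j \in C :&: upper D.
    move=> b'D; have bjD := upperW _ _ _ b'D (le_b' j); rewrite inE bjD andbT bC //.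
    apply: contraNneq Dset0 => bj0; have /upperP[S SD] := bjD.
    by rewrite bj0 subset0 => /eqP <-.
  (* If [D] differed from [C], its certificate would bound [n.+1] by [k_of k D] plus the number of
     columns of [b] in [C :&: upper D], against [condC]. *)
  have [DC|neDC] := eqVneq D C; last first.
    have := condC D antiD D0 neDC; have := card_split C D.
    have : #|[set j | b' j \in upper D]| <= #|[set j | b j \in C :&: upper D]|.
      apply: subset_leq_card; apply/subsetP => j.
      by rewrite inE => /bD bjD; rewrite inE.
    have : D \subset lower C.
      apply/subsetP => T; rewrite inE => /andP[_ /existsP[j sTb]]; apply/lowerP.
      have sTbj := subset_trans sTb (le_b' j).
      have [bj0|/bC bjC] := eqVneq (b j) set0; last by exists (b j).
      have /set0Pn[S SC] := C0; exists S => //.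
      by apply: subset_trans sTbj _; rewrite bj0 sub0set.
    by move=> -> ? ? /(_ isT); lia.
  rewrite DC in ltD bD.
  (* The certificate leaves [b'] at least [n.+1 - k_of k C] columns in [upper C], so no column of
     [b] in [C] is lost; the member of [C] below [b' j] then equals [b j] by the antichain
     property. *)
  have eqC : [set j | b' j \in upper C] = [set j | b j \in C].
    apply/eqP; rewrite eqEcard; apply/andP; split; last by lia.
    by apply/subsetP => j; rewrite inE => /bD /setIP[bjC _]; rewrite inE.
  move=> j; have [bj0|/bC bjC] := eqVneq (b j) set0.
    by apply/eqP; have := le_b' j; rewrite bj0 subset0.
  have /setP/(_ j) := eqC; rewrite !inE bjC => /exists_inP[S SC sS].
  apply/eqP; rewrite eqEsubset le_b' /=.
  by rewrite -(antichainP _ antiC S (b j)) // (subset_trans sS).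
(* With a smallest lower set, no other antichain inside [lower C] can cover. *)
have [C /= covC minC] := arg_minnP (fun C => #|lower C|) cov0.
have /and3P[antiC C_n0 ltC] := covC.
have Cset0 := set0_notin _ (k_gt0 _ _ covC).
(* The family [b'] retains [n.+1 - k_of k C] columns, the least number for which [C] still
   certifies, shrinks each to a member of [C] and empties the rest. Minimality forces [b'] to be
   [b]. *)
have [J sJ cardJ] := @subset_of_card _ [set j | b j \in upper C] (n.+1 - k_of k C)
  ltac:(by rewrite leq_subLR).
pose b' j := if j \in J then odflt set0 [pick T in C | T \subset b j] else set0.
have b'C j : j \in J -> b' j \in C /\ b' j \subset b j.
  move=> jJ; rewrite /b' jJ; case: pickP => [T /andP[] //|noT].
  have := subsetP sJ j jJ; rewrite inE => /upperP[T TC sT].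
  by have := noT T; rewrite TC sT.
have b'N j : j \notin J -> b' j = set0 by rewrite /b' => /negPf ->.
have b'E : b' =1 b.
  apply: minb => [j|].
    by case: (boolP (j \in J)) => [/b'C[]|/b'N->] //; rewrite sub0set.
  exists C; rewrite /covers_by antiC C_n0 /=.
  have : #|J| <= #|[set j | b' j \in upper C]|.
    apply: subset_leq_card; apply/subsetP => j /b'C[bC _]; rewrite inE.
    exact: (subsetP (sub_upper C)).
  by rewrite cardJ leq_subLR.
have cardC : #|[set j | b j \in C]| + k_of k C = n.+1.
  have <- : J = [set j | b j \in C].
    apply/setP => j; rewrite inE -b'E; apply/idP/idP => [/b'C[]//|].
    by apply: contraLR => /b'N ->.
  by rewrite cardJ subnK // ltnW // ltnS.
exists C; split; first by split=> //; apply: k_gt0 covC.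
split=> // [j|C' antiC' C'0 neC' sC'].
  by rewrite -b'E; case: (boolP (j \in J)) => [/b'C[]|/b'N->] //; rewrite eqxx.
rewrite ltnNge; apply/negP => le_k.
have covC' : covers_by b C'.
  rewrite /covers_by antiC' C'0 -cardC (card_split C C') /=.
  have : #|[set j | b j \in C :&: upper C']| <= #|[set j | b j \in upper C']|.
    apply: subset_leq_card; apply/subsetP => j.
    by rewrite inE => /setIP[_ bjC']; rewrite inE.
  by move=> leI; rewrite -addnA addnC leq_add // addnC.
have slowC : lower C' \subset lower C.
  apply/subsetP => T /lowerP[S /(subsetP sC')/lowerP[S' S'C sSS'] sTS].
  by apply/lowerP; exists S' => //; apply: subset_trans sSS'.
have lowE : lower C' = lower C by apply/eqP; rewrite eqEcard slowC minC.
have /eqP[] := neC'; apply: lower_inj => //; rewrite lowE.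
by apply/subsetP => S SC; apply/lowerP; exists S.
Qed.

End Cover.
End Count.
End Families.

Import GRing.Theory.
Local Open Scope ring_scope.

(** * Monomial ideals *)

Section IdealGen.
Variable R : comNzRingType.
Implicit Types S : R -> Prop.

Lemma ideal_gen_ideal S : is_ideal (ideal_gen S).
Proof.
split=> [I [] //|a b Ia Ib I idI SI|r a Ia I idI SI]; have [_ ID IM] := idI.
- by apply: ID; [apply: Ia|apply: Ib].
- by apply: IM; apply: Ia.
Qed.

Lemma mem_ideal_gen S : incl_pred S (ideal_gen S).
Proof. by move=> p Sp I _; apply. Qed.

Lemma eq_ideal_gen S S' :
  eq_pred S S' -> eq_pred (ideal_gen S) (ideal_gen S').
Proof.
by move=> eqS p; split=> Ip I idI SI; apply: Ip => // q /eqS; apply: SI.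
Qed.

End IdealGen.

Section MonomialIdeal.
Context {F : fieldType} {N : nat}.
Implicit Types (M : 'X_{1..N} -> Prop) (m u w : 'X_{1..N}) (p q : {mpoly F[N]}).

Definition mon_ideal M : {mpoly F[N]} -> Prop :=
  ideal_gen (fun p => exists2 u, M u & p = 'X_[u]).

Lemma mon_ideal_ideal M : is_ideal (mon_ideal M).
Proof. exact: ideal_gen_ideal. Qed.

Lemma mem_mon_ideal M u : M u -> mon_ideal M 'X_[u].
Proof. by move=> Mu; apply: mem_ideal_gen; exists u. Qed.

(** The polynomials whose terms are all divisible by generators form an ideal; conversely such a
    polynomial is the sum of its terms. *)
Lemma mon_idealP M p :
  mon_ideal M p <->
  (forall w, w \in msupp p -> exists2 u, M u & (u <= w)%MM).
Proof.
split=> [|suppM].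
  move/(_ (fun q => forall w, w \in msupp q -> exists2 u, M u & (u <= w)%MM)).
  apply=> [|_ [u Mu ->] w /mem_msuppXP <-]; last by exists u; rewrite ?lepm_refl.
  split=> [w|a b Ia Ib w /msuppD_le|r a Ia w /msuppM_le]; first by rewrite msupp0.
    by rewrite mem_cat => /orP[/Ia|/Ib].
  case/allpairsP=> -[w1 w2] /= [_ /Ia[u Mu le_u] ->]; exists u => //.
  by apply: lepm_trans le_u _; rewrite lem_addl.
have [I0 ID IM] := mon_ideal_ideal M.
rewrite [p]mpolyE big_seq; apply: (big_ind (mon_ideal M)) => // w.
move=> /suppM[u Mu le_u]; rewrite -(submK le_u) mpolyXD -mul_mpolyC mulrA.
exact: IM (mem_mon_ideal _ _ Mu).
Qed.

Lemma mon_ideal_monP M w :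
  mon_ideal M 'X_[w] <-> (exists2 u, M u & (u <= w)%MM).
Proof.
rewrite mon_idealP; split=> [|Mw w' /mem_msuppXP <- //]; apply.
exact/mem_msuppXP.
Qed.

Lemma monomial_primeP m p :
  monomial_prime m p <->
  (forall w, w \in msupp p -> exists l, (0 < m l)%N && (0 < w l)%N).
Proof.
have lt0U l u : (U_(l) <= u)%MM = (0 < u l)%N.
  apply/mnm_lepP/idP => [/(_ l)|u_gt0 i]; first by rewrite mnm1E eqxx.
  by rewrite mnm1E; case: eqP => [<-|].
pose M u := exists2 l, (U_(l) <= m)%MM & u = U_(l)%MM.
have eqM : eq_pred (monomial_prime m) (mon_ideal M).
  apply: eq_ideal_gen => q; split=> [[l le_l ->]|[_ [l le_l ->] ->]]; last by exists l.
  by exists U_(l)%MM => //; exists l.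
split=> [/eqM/mon_idealP|] suppM.
  move=> w /suppM[_ [l le_l ->] le_w]; exists l.
  by rewrite -!lt0U le_l.
apply/eqM/mon_idealP => w /suppM[l /andP[m_l w_l]].
by exists U_(l)%MM; rewrite ?lt0U //; exists l; rewrite ?lt0U.
Qed.

Lemma monomial_primeX m w :
  @monomial_prime F N m 'X_[w] <-> (exists l, (0 < m l)%N && (0 < w l)%N).
Proof.
rewrite monomial_primeP; split=> [|Mw w' /mem_msuppXP <- //]; apply.
exact/mem_msuppXP.
Qed.

Lemma monomial_prime_prime m : is_prime_ideal (@monomial_prime F N m).
Proof.
pose P := @monomial_prime F N m; have idP : is_ideal P by apply: ideal_gen_ideal.
have [P0 PD PM] := idP.
pose hit w := [exists l, (0 < m l)%N && (0 < w l)%N].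
split=> // [/monomial_primeP/(_ 0%MM)|a b Pab].
  by rewrite msupp1 inE eqxx => /(_ isT)[l]; rewrite mnm0E andbF.
(* [low p] collects the terms of [p] free of the variables of [m]. *)
pose low p := \sum_(w <- msupp p | ~~ hit w) p@_w *: 'X_[w].
have low_msupp p w : w \in msupp (low p) -> ~~ hit w.
  case/msupp_sum_le/flatten_mapP=> u; rewrite mem_filter => /andP[hu _].
  by move/msuppZ_le; rewrite msuppX inE => /eqP->.
have sub_low p : P (p - low p).
  rewrite {1}[p]mpolyE (bigID hit) /= addrK.
  apply: (big_ind P) => // w /existsP hw.
  by rewrite -mul_mpolyC; apply: PM; apply/monomial_primeX.
have low_eq0 p : low p = 0 -> P p by move=> p0; have:= sub_low p; rewrite p0 subr0.
have [/low_eq0|a_n0] := eqVneq (low a) 0; [by left|].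
have [/low_eq0|b_n0] := eqVneq (low b) 0; [by right|].
(* Modulo [P] the product of the low parts is [a * b]. Being nonzero, it has a leading monomial,
   which would have to meet [m] although both its factors avoid [m]. *)
have /monomial_primeP Plow : P (low a * low b).
  have ->: low a * low b = a * b + (- low b * (a - low a) - a * (b - low b)).
    by rewrite !mulrBr !mulNr [low b * a]mulrC [low b * low a]mulrC; ring.
  by apply: (PD) => //; apply: (PD); [|rewrite -mulNr]; apply: (PM).
have ab_n0 : low a * low b != 0 by rewrite mulf_neq0.
have [l] := Plow _ (mlead_supp ab_n0).
have /msuppM_le/allpairsP[[w1 w2] /= [w1_a w2_b ->]] := mlead_supp ab_n0.
rewrite mnmDE => /andP[m_l]; rewrite addn_gt0 => w_l.
have := low_msupp _ _ w1_a; have := low_msupp _ _ w2_b.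
by case/orP: w_l => w_l /existsPn/(_ l) + /existsPn/(_ l); rewrite m_l w_l.
Qed.

(** The two conditions make [m] a minimal vertex cover of the generators: it meets each of them, and
    each of its variables has a private generator that meets [m] nowhere else. *)
Lemma associated_monomial_prime M m :
    (forall u, M u -> squarefree u) -> squarefree m ->
  associated_prime (mon_ideal M) (monomial_prime m) <->
  (forall u, M u -> exists l, (0 < m l)%N && (0 < u l)%N) /\
  (forall l, (0 < m l)%N -> exists2 u, M u &
     (0 < u l)%N /\ forall l', (0 < m l')%N && (0 < u l')%N -> l' = l).
Proof.
move=> sqM sqm; have [I0 ID IM] := mon_ideal_ideal M.
have primeP := @monomial_prime_prime m; split; last first.
  case=> cov priv; split=> //.
  (* [P_m] annihilates the product of the variables outside [m]. *)
  pose w := [multinom (m l == 0)%N : nat | l < N]; exists 'X_[w] => g.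
  have [idP _ Pmul] := primeP; split=> [|Ig].
    move/(_ (fun q => mon_ideal M (q * 'X_[w]))); apply=> [|_ [l le_l ->]].
      split=> [|a b Ia Ib|r a Ia]; rewrite ?mul0r ?mulrDl -?mulrA //.
        exact: ID.
      exact: IM.
    have m_l : (0 < m l)%N by have/mnm_lepP/(_ l) := le_l; rewrite mnm1E eqxx.
    have [u Mu [u_l uniq]] := priv l m_l.
    rewrite -mpolyXD; apply/mon_ideal_monP; exists u => //; apply/mnm_lepP => i.
    rewrite mnmDE mnm1E mnmE; have /forallP/(_ i) := sqM u Mu.
    have [<-|ne_li] := eqVneq l i; first by move/leq_trans; apply.
    have := uniq i; case: (u i) => // ui /=; case: (m i) => [|mi] //= il.
    by rewrite il ?eqxx in ne_li.
  have Pgw : monomial_prime m (g * 'X_[w]).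
    apply/monomial_primeP => w' /((mon_idealP _ _).1 Ig)[u Mu le_u].
    have [l /andP[m_l u_l]] := cov u Mu; exists l; rewrite m_l.
    by have /mnm_lepP/(_ l) := le_u; lia.
  case: (Pmul _ _ Pgw) => // /monomial_primeX[l].
  by rewrite mnmE; case: (m l).
case=> _ [f annf].
have cov u : M u -> exists l, (0 < m l)%N && (0 < u l)%N.
  move=> Mu; apply/monomial_primeX/annf; rewrite mulrC.
  exact: IM (mem_mon_ideal _ _ Mu).
split=> // l0 m_l0.
pose inI w := exists2 u, M u & (u <= w)%MM.
have nIf : ~ mon_ideal M f.
  move=> If; have [_ + _] := primeP; apply; apply/annf.
  by rewrite mul1r.
(* Since [f] is not in the ideal, some term [w] of it lies outside. Its multiple by any variable of
   [m] lies inside, because membership is tested term by term. *)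
have [w w_f nIw] : exists2 w, w \in msupp f & ~ inI w.
  apply: NNPP => noW; apply/nIf/mon_idealP => w w_f; apply: NNPP => nw.
  by apply: noW; exists w.
(* The generators are squarefree, so [w] cannot involve a variable of [m]. *)
have priv l : (0 < m l)%N -> exists2 u, M u &
    (u <= U_(l) + w)%MM /\ ~ (u <= w)%MM.
  move=> m_l; have /annf : monomial_prime m ('X_l : {mpoly F[N]}).
    by apply/monomial_primeX; exists l; rewrite m_l mnm1E eqxx.
  rewrite mulrC => /mon_idealP/(_ (U_(l) + w)%MM)[|u Mu le_u].
    by rewrite (perm_mem (msuppMX _ _)) map_f.
  by exists u => //; split=> // le_uw; apply: nIw; exists u.
have w0 l : (0 < m l)%N -> w l = 0%N.
  move=> /priv[u Mu [/mnm_lepP le_u nle]]; apply/eqP; rewrite -leqn0 leqNgt.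
  apply/negP=> w_l; apply: nle; apply/mnm_lepP => i; have:= le_u i.
  rewrite mnmDE mnm1E; case: eqVneq => [<- _|//].
  by have /forallP/(_ l) := sqM u Mu; lia.
have [u Mu [/mnm_lepP le_u nle]] := priv l0 m_l0; exists u => //; split.
  rewrite lt0n; apply/negP => /eqP u0; apply: nle; apply/mnm_lepP => i.
  have:= le_u i; rewrite mnmDE mnm1E; case: eqVneq => [<-|//].
  by rewrite u0.
move=> i /andP[/w0 wi ui]; have := le_u i.
by rewrite mnmDE mnm1E wi; case: eqVneq => // _; rewrite leqNgt ui.
Qed.

(** Any monomial generating set contains a divisor [w] of [u], and [w] has a divisor in [M], which
    is [u] by incomparability; so [u] itself belongs to every such set. *)
Lemma unique_minimal_monomial_generatorsP M (I G : {mpoly F[N]} -> Prop) :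
    (forall u w, M u -> M w -> (u <= w)%MM -> u = w) ->
    eq_pred I (mon_ideal M) -> eq_pred G (fun p => exists2 u, M u & p = 'X_[u]) ->
  unique_minimal_monomial_generators I G.
Proof.
move=> antiM IE GE.
have genG : eq_pred (ideal_gen G) I.
  by move=> p; apply: iff_trans (iff_sym (IE p)); apply: eq_ideal_gen.
have subG (G' : {mpoly F[N]} -> Prop) : incl_pred G' (@is_monomial F N) ->
    eq_pred (ideal_gen G') I -> incl_pred G G'.
  move=> monG' eqG' _ /GE[u Mu ->]; pose M' w := G' 'X_[w].
  have eqM' : eq_pred (mon_ideal M') (ideal_gen G').
    apply: eq_ideal_gen => p; split=> [[w M'w ->] //|G'p].
    by have [w pE] := monG' p G'p; exists w; rewrite // /M' -pE.
  have /IE/eqG'/eqM'/mon_ideal_monP[w G'w le_wu] := mem_mon_ideal M u Mu.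
  have /eqG'/IE/mon_ideal_monP[v Mv le_vw] : ideal_gen G' 'X_[w].
    exact: mem_ideal_gen.
  have vu : v = u by apply: antiM => //; apply: lepm_trans le_wu.
  suff -> : u = w by [].
  apply/mnmP => i; apply/eqP; rewrite eqn_leq; apply/andP; split.
    by rewrite -vu; apply/mnm_lepP.
  by apply/mnm_lepP.
have monG : incl_pred G (@is_monomial F N) by move=> _ /GE[u _ ->]; exists u.
split=> [|G' [monG' eqG' minG'] p].
  by split=> // G' subG' eqG'; apply: subG => // p /subG'/monG.
by split; [apply: minG' => //; apply: subG | apply: subG].
Qed.

End MonomialIdeal.

(** * Matrices *)

Section MatrixMonomials.
Context {c n : nat}.
Implicit Types (A B : 'M[bool]_(c, n)) (s : 'S_n) (J : {set {set 'I_c}}).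

Definition colset B (j : 'I_n) : {set 'I_c} := [set i | B i j].

Definition mxmon B : 'X_{1..nvars c n} :=
  [multinom nat_of_bool (B (enum_val l).1 (enum_val l).2) | l < nvars c n].

Lemma mxmonE B i j : mxmon B (enum_rank (i, j)) = B i j.
Proof. by rewrite mnmE enum_rankK. Qed.

Lemma mxmon_le A B :
  (mxmon A <= mxmon B)%MM <-> forall j, colset A j \subset colset B j.
Proof.
split=> [/mnm_lepP le_AB j|sAB].
  apply/subsetP => i; rewrite !inE; have := le_AB (enum_rank (i, j)).
  by rewrite !mxmonE; case: (A i j) => //; case: (B i j).
apply/mnm_lepP => l; rewrite !mnmE.
have /subsetP/(_ (enum_val l).1) := sAB (enum_val l).2; rewrite !inE.
by case: (A _ _) => // ->.
Qed.

Lemma colset_inj A B : colset A =1 colset B -> A = B.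
Proof.
by move=> eqAB; apply/matrixP => i j; have /setP/(_ i) := eqAB j; rewrite !inE.
Qed.

Lemma colset_col_perm s B j : colset (col_perm s B) j = colset B (s j).
Proof. by apply/setP => i; rewrite !inE mxE. Qed.

Lemma squarefree_mxmon u : squarefree u <-> exists B, u = mxmon B.
Proof.
split=> [/forallP sq_u|[B ->]]; last first.
  by apply/forallP => l; rewrite mnmE; case: (B _ _).
exists (\matrix_(i, j) (0 < u (enum_rank (i, j)))%N); apply/mnmP => l.
rewrite mnmE mxE -surjective_pairing enum_valK.
by have := sq_u l; case: (u l) => [|[]].
Qed.

Section Field.
Variable F : fieldType.

Lemma xmonE B : xmon F B = 'X_[mxmon B].
Proof.
rewrite /xmon pair_bigA mpolyXE_id (reindex enum_rank) /=; last first.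
  by exists enum_val => x _; rewrite ?enum_rankK ?enum_valK.
by apply: eq_bigr => -[i j] _; rewrite mxmonE.
Qed.

(** Column [j] moves to position [s j], so column [j] of the new matrix is column [s^-1 j] of the
    old one. *)
Lemma sym_act_xmon s B : sym_act s (xmon F B) = xmon F (col_perm s^-1 B).
Proof.
rewrite xmonE /sym_act comp_mpolyX (reindex enum_rank) /=; last first.
  by exists enum_val => x _; rewrite ?enum_rankK ?enum_valK.
rewrite /xmon pair_bigA [RHS](reindex (fun p : 'I_c * 'I_n => (p.1, s p.2))) /=.
  by apply: eq_bigr => -[i j] _; rewrite mxmonE tnth_mktuple enum_rankK mxE permK.
by exists (fun p => (p.1, s^-1%g p.2)) => -[i j] _ /=; rewrite ?permK ?permKV.
Qed.

Lemma sym_orbits_xmonP (X : 'M[bool]_(c, n) -> Prop)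
    (Y : {mpoly F[nvars c n]} -> Prop) p :
    (forall q, Y q <-> exists2 B, X B & q = xmon F B) ->
  sym_orbits Y p <->
  exists2 u, exists s B, X B /\ u = mxmon (col_perm s B) & p = 'X_[u].
Proof.
move=> YE; split=> [[s [_ [/YE[B XB ->] ->]]]|[_ [s [B [XB ->]]] ->]].
  exists (mxmon (col_perm s^-1 B)); last by rewrite sym_act_xmon xmonE.
  by exists s^-1%g, B.
exists s^-1%g, (xmon F B); split; first by apply/YE; exists B.
by rewrite sym_act_xmon xmonE invgK.
Qed.

Lemma associated_prime_eq (I I' P : {mpoly F[nvars c n]} -> Prop) : eq_pred I I' ->
  associated_prime I P <-> associated_prime I' P.
Proof.
move=> eqI; split=> -[primeP [f Pf]]; split=> //; exists f => g.
  by apply: iff_trans (Pf g) (eqI _).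
by apply: iff_trans (Pf g) (iff_sym (eqI _)).
Qed.

Lemma associated_minimal_cover (A : 'M[bool]_(c, n)) k B :
    (forall J, set0 \notin J ->
       #|[set t | colset A t \in J]| = (\sum_(T in J) k T)%N) ->
  associated_prime (@mon_ideal F _ (fun u => exists s, u = mxmon (col_perm s A)))
    (monomial_prime (mxmon B)) <-> minimal_cover k n (colset B).
Proof.
move=> A_count; pose a := colset A.
have meetP (b : {set 'I_c}) t :
    reflect (exists2 i, i \in a t & i \in b) (~~ (a t \subset ~: b)).
  apply: (iffP subsetPn) => -[i ia ib]; exists i => //.
    by rewrite inE negbK in ib.
  by rewrite inE negbK.
have covP b := coverP k n a b A_count.
rewrite associated_monomial_prime; last 2 first.
- by move=> _ [s ->]; apply/squarefree_mxmon; exists (col_perm s A).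
- by apply/squarefree_mxmon; exists B.
have lt0_mx A' l : (0 < mxmon A' l)%N = A' (enum_val l).1 (enum_val l).2.
  by rewrite mnmE; case: (A' _ _).
split=> [[cov priv]|[covB minB]].
  split=> [|b' le_b' /covP cov' j].
    apply/covP => s; have [|l] := cov (mxmon (col_perm s A)); first by exists s.
    rewrite !lt0_mx mxE => /andP[Bl Al]; exists (enum_val l).2.
    by apply/meetP; exists (enum_val l).1; rewrite inE.
  apply/eqP; rewrite eqEsubset le_b' /=; apply/subsetP => i; rewrite inE => Bij.
  (* The cover [b'] meets the orbit element private to the variable at [(i, j)]; as that element
     meets [B] only there, [b'] contains this variable. *)
  have [|_ [s ->] [_ uniq]] := priv (enum_rank (i, j)).
    by rewrite mxmonE Bij.
  have [j' /meetP[i' ia ib]] := cov' s.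
  have := uniq (enum_rank (i', j')); rewrite !mxmonE mxE.
  have := subsetP (le_b' j') i' ib; rewrite !inE in ia * => -> /=.
  by rewrite ia => /(_ isT)/enum_rank_inj[<- <-].
split=> [_ [s ->]|l Bl].
  have [j /meetP[i]] := (covP _).2 covB s; rewrite !inE => Aij Bij.
  by exists (enum_rank (i, j)); rewrite !mxmonE mxE Aij Bij.
rewrite lt0_mx in Bl; case: (enum_val l) (enum_valK l) Bl => i j /= <- Bij.
(* Deleting one variable from a minimal cover leaves some orbit element missed, and that element is
   the private generator sought. *)
pose b' j' := if j' == j then colset B j :\ i else colset B j'.
have [s s_priv] : exists s : 'S_n, forall j', a (s j') \subset ~: b' j'.
  apply: NNPP => noS.
  have /minB/(_ _ j)/setP/(_ i) : forall j', b' j' \subset colset B j'.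
    by move=> j'; rewrite /b'; case: eqP => [->|//]; rewrite subsetDl.
  rewrite /b' eqxx !inE eqxx Bij /=; suff cov' : exists C, covers_by k n b' C.
    by move=> /(_ cov').
  apply/covP => s; apply: NNPP => nj; apply: noS; exists s => j'.
  by apply: contraT => nsub; case: nj; exists j'.
have uniq i' j' : A i' (s j') -> B i' j' -> (i', j') = (i, j).
  move=> Aij' Bij'; have /subsetP/(_ i') := s_priv j'; rewrite !inE => /(_ Aij').
  rewrite /b'; case: eqP => [jj|_]; rewrite !inE; last by rewrite Bij'.
  by rewrite -jj Bij' andbT negbK => /eqP ->.
exists (mxmon (col_perm s A)); [by exists s|split].
  have [j' /meetP[i']] := (covP _).2 covB s; rewrite !inE => Aij' Bij'.
  by rewrite mxmonE mxE; case: (uniq i' j' Aij' Bij') => <- <-; rewrite Aij'.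
move=> l'; rewrite !lt0_mx mxE => /andP[Bl' Al'].
by rewrite -[l']enum_valK -(uniq _ _ Al' Bl') -surjective_pairing.
Qed.

End Field.
End MatrixMonomials.

Lemma perm_of_eq_count {T : finType} {n : nat} (f g : 'I_n -> T) :
  (forall y, #|[set t | f t == y]| = #|[set t | g t == y]|) ->
  exists s : 'S_n, forall t, f t = g (s t).
Proof.
move=> eqfg; have /tuple_permP[s fE] : perm_eq [tuple f t | t < n] [tuple g t | t < n].
  have countE (h : 'I_n -> T) y :
      count_mem y [tuple h t | t < n] = #|[set t | h t == y]|.
    rewrite -sum1dep_card -sum1_count big_map.
    by rewrite big_enum_cond.
  by apply/allP => y _; rewrite /= !countE eqfg.
exists s => t; have /(congr1 (fun x => tnth x t)) := val_inj fE.
by rewrite !tnth_mktuple.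
Qed.

(** * Column multiplicities of block matrices and the sets [MG] *)

Section Concat.
Context {c : nat}.
Implicit Types (k : {set 'I_c} -> nat) (S J : {set {set 'I_c}}).

Lemma colset_pad_concat n S k (t : 'I_n) :
  colset (pad_cols n (A_concat S k)) t =
  if insub (val t) is Some x
  then enum_val (tagnat.sig1 (x : 'I_(\sum_(y < #|S|) k (enum_val y))))
  else set0.
Proof.
by apply/setP => i; rewrite inE mxE; case: insub => [x|]; rewrite ?inE // !mxE.
Qed.

Lemma card_colset_concat n S k J :
    (\sum_(T in S) k T <= n)%N -> set0 \notin J ->
  #|[set t | colset (pad_cols n (A_concat S k)) t \in J]| = (\sum_(T in J :&: S) k T)%N.
Proof.
rewrite big_enum_val => le_wn J0; set w := (\sum_(x < #|S|) k (enum_val x))%N in le_wn.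
pose h (t : 'I_w) : {set 'I_c} := enum_val (tagnat.sig1 t).
have -> : [set t | colset (pad_cols n (A_concat S k)) t \in J] =
    widen_ord le_wn @: [set t | h t \in J].
  apply/setP => t; rewrite inE; apply/idP/imsetP => [|[u + ->]].
    rewrite colset_pad_concat; case: insubP => [x _ xt|_]; last by rewrite (negPf J0).
    by move=> xJ; exists x; [rewrite inE | apply: val_inj; rewrite /= -xt].
  by rewrite inE colset_pad_concat /= valK.
rewrite card_imset; last by move=> u v /(congr1 val) /= /val_inj.
rewrite -sum1dep_card (reindex tagnat.rank) /=; last exact/onW_bij/tagnat.rank_bij.
transitivity (\sum_(x < #|S| | enum_val x \in J) \sum_(y < k (enum_val x)) 1)%N.
  rewrite sig_big_dep /=; apply: eq_bigl => p.
  by rewrite /h /tagnat.sig1 tagnat.rankK andbT.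
rewrite (eq_bigr (fun x => k (enum_val x))); last first.
  by move=> x _; rewrite sum1_card card_ord.
rewrite big_mkcond -(big_enum_val (fun T => if T \in J then k T else 0%N)) -big_mkcondr.
by apply: eq_bigl => T; rewrite inE andbC.
Qed.

Lemma card_colset_partition {n} (b : 'I_n -> {set 'I_c}) J :
  #|[set t | b t \in J]| = (\sum_(T in J) #|[set t | b t == T]|)%N.
Proof.
rewrite -sum1dep_card (partition_big b (mem J)) //=; apply: eq_bigr => T TJ.
by rewrite -sum1dep_card; apply: eq_bigl => t; case: eqP => [->|]; rewrite ?TJ ?andbF.
Qed.

Lemma card_col_perm {n} (s : 'S_n) (B : 'M[bool]_(c, n)) J :
  #|[set t | colset (col_perm s B) t \in J]| = #|[set t | colset B t \in J]|.
Proof.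
rewrite -(card_imset [set t | colset (col_perm s B) t \in J] (@perm_inj _ s)).
apply: eq_card => t.
apply/imsetP/idP => [[u + ->]|]; rewrite !inE.
  by rewrite colset_col_perm.
by move=> tJ; exists (s^-1%g t); rewrite ?permKV // inE colset_col_perm permKV.
Qed.

(** The criterion [minimal_coverP] involves only multiplicities of columns, so a minimal cover can
    be rearranged into the block matrix with the same multiplicities. *)
Lemma minimal_cover_MG {n} k (B : 'M[bool]_(c, n)) : (\sum_T k T <= n)%N ->
  minimal_cover k n (colset B) <->
  exists s B0, (exists C, [/\ antichain C, C != set0, (1 <= k_of k C)%N & MG k C B0])
    /\ B = col_perm s B0.
Proof.
move=> le_kn; rewrite minimal_coverP //; split.
  case=> C [[antiC C0 kC] [bC cardC condC]]; have Cset0 := set0_notin k C kC.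
  pose j T := #|[set t | colset B t == T]|.
  pose B0 : 'M[bool]_(c, n) := pad_cols n (A_concat C j).
  have sum_j : (\sum_(T in C) j T)%N = #|[set t | colset B t \in C]|.
    by rewrite card_colset_partition.
  have card_B0 J : set0 \notin J ->
      #|[set t | colset B t \in J]| = #|[set t | colset B0 t \in J]|.
    move=> J0; rewrite card_colset_concat //; last by rewrite sum_j; lia.
    rewrite card_colset_partition (big_setID C) /= [X in (_ + X)%N]big1 ?addn0 //.
    move=> T /setDP[TJ TC]; apply: eq_card0 => t; rewrite !inE.
    apply: contraNF TC => /eqP bT; rewrite -bT; apply: bC.
    by apply: contraNneq J0 => t0; rewrite -t0 bT.
  have cover_MG : MG k C B0.
    exists j; split=> // [|C' antiC' C'0 neC' sC']; first by rewrite sum_j; lia.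
    rewrite Num.Theory.ltrBlDl -PoszD ltz_nat -(card_colset_partition (colset B)).
    exact: condC.
  have [T|s sE] := @perm_of_eq_count _ _ (colset B) (colset B0).
    have countE b : #|[set t | b t == T]| = #|[set t : 'I_n | b t \in [set T]]|.
      by apply: eq_card => t; rewrite !inE.
    (* Zero columns escape [card_B0]; their number is [n] minus the number of nonzero columns, on
       which both matrices agree. *)
    have [->|T0] := eqVneq T set0; last by rewrite !countE card_B0 // inE eq_sym.
    apply: (@addIn #|[set t | colset B t \in ~: [set set0]]|).
    rewrite {2}card_B0; last by rewrite !inE eqxx.
    have countC b : (#|[set t : 'I_n | b t == set0]| +
        #|[set t | b t \in ~: [set set0]]| = n)%N.
      rewrite -[RHS]card_ord -(cardsC [set t | b t == set0]); congr (_ + _)%N.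
      by apply: eq_card => t; rewrite !inE.
    by rewrite !countC.
  exists s, B0; split; first by exists C.
  by apply: colset_inj => t; rewrite colset_col_perm.
case=> s [B0 [[C [antiC C0 kC [j [B0E sum_j cond_j]]]] ->]].
have Cset0 := set0_notin k C kC.
have sum_jE : (\sum_(T in C) j T = n.+1 - k_of k C)%N by lia.
have count_B0 J : set0 \notin J -> J \subset C ->
    #|[set t | colset (col_perm s B0) t \in J]| = (\sum_(T in J) j T)%N.
  move=> J0 sJC; rewrite card_col_perm B0E card_colset_concat ?(setIidPl sJC) //.
  by rewrite sum_jE; lia.
exists C; split=> //; split=> [t|| C' antiC' C'0 neC' sC'].
- rewrite colset_col_perm B0E colset_pad_concat.
  by case: insub => [x _|]; [apply: enum_valP | rewrite eqxx].
- by rewrite count_B0 // sum_jE subnK //; apply: leq_trans (k_of_le k C) _; apply: ltnW.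
rewrite count_B0 ?subsetDl //; last by rewrite inE (negPf Cset0) andbF.
by have := cond_j C' antiC' C'0 neC' sC'; rewrite Num.Theory.ltrBlDl -PoszD ltz_nat.
Qed.

End Concat.

(** * The Alexander dual of the orbit ideal *)

Theorem theorem5p8 (F : fieldType) (c m n : nat) (k : {set 'I_c} -> nat)
    (m_def : m = (\sum_(T : {set 'I_c}) k T)%N)
    (A_neq0 : A_concat [set: {set 'I_c}] k <> const_mx false)
    (le_m_n : (m <= n)%N)
    (le_max_n :
      (\max_(C : {set {set 'I_c}}
               | [&& antichain C, C != set0 & (1 <= k_of k C)%N])
          (k_of k C - 1) <= n)%N) :
  unique_minimal_monomial_generators
    (alexander_dual (I_n F n (A_concat [set: {set 'I_c}] k)))
    (sym_orbits (fun p : {mpoly F[nvars c n]} =>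
       exists (C : {set {set 'I_c}}) (B : 'M[bool]_(c, n)),
         [/\ antichain C, C != set0, (1 <= k_of k C)%N, MG k C B
           & p = xmon F B])).
Proof.
have le_kn : (\sum_T k T <= n)%N by rewrite -m_def.
pose A := pad_cols n (A_concat [set: {set 'I_c}] k).
have A_count (J : {set {set 'I_c}}) : set0 \notin J ->
    #|[set t | colset A t \in J]| = (\sum_(T in J) k T)%N.
  move=> J0; rewrite -[in RHS](setIT J); apply: card_colset_concat => //.
  by rewrite (eq_bigl xpredT) // => T; rewrite inE.
(* [D] collects the exponents of minimal covers; it is matched with the associated primes on one
   side and with the orbits of the [MG] matrices on the other. *)
pose D u := exists2 B, minimal_cover k n (colset B) & u = mxmon B.
have IE : eq_pred (I_n F n (A_concat [set: {set 'I_c}] k))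
    (mon_ideal (fun u => exists s, u = mxmon (col_perm s A))).
  apply: eq_ideal_gen => p; rewrite (sym_orbits_xmonP _ (fun B => B = A)); last first.
    by move=> q; split=> [->|[_ -> ->//]]; exists A.
  split=> [[u [s [_ [-> ->]] ->]]|[u [s ->] ->]].
    by exists (mxmon (col_perm s A)) => //; exists s.
  by exists (mxmon (col_perm s A)) => //; exists s, A.
have DE u : squarefree u /\ associated_prime (I_n F n (A_concat [set: {set 'I_c}] k))
    (monomial_prime u) <-> D u.
  rewrite (associated_prime_eq _ _ _ _ IE).
  split=> [[/squarefree_mxmon[B ->] assB]|[B minB ->]].
    by exists B => //; move/(associated_minimal_cover _ _ _ _ A_count): assB.
  split; first by apply/squarefree_mxmon; exists B.
  exact/(associated_minimal_cover _ _ _ _ A_count).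
apply: (@unique_minimal_monomial_generatorsP _ _ D).
(* A cover dividing a minimal cover equals it, so [D] is an antichain for divisibility. *)
- move=> _ _ [B [covB _] ->] [B' [_ minB'] ->] /mxmon_le le_BB'.
  by congr mxmon; apply: colset_inj; apply: minB'.
- apply: eq_ideal_gen => p.
  split=> [[u [sq_u assu ->]]|[u /DE[sq_u assu] ->]]; exists u => //.
  exact/DE.
move=> p; rewrite (sym_orbits_xmonP _ (fun B0 => exists C, [/\ antichain C, C != set0,
  (1 <= k_of k C)%N & MG k C B0])); last first.
  move=> q; split=> [[C [B [aC C0 kC MGB ->]]]|[B [C [aC C0 kC MGB]] ->]].
    by exists B => //; exists C.
  by exists C, B.
split=> [[u [s [B0 [MGB ->]]] ->]|[u [B minB ->] ->]]; eexists=> //.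
  by exists (col_perm s B0) => //; apply/minimal_cover_MG => //; exists s, B0.
by have /(minimal_cover_MG _ _ le_kn)[s [B0 [MGB ->]]] := minB; exists s, B0.
Qed.
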